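(* Let $G$ be a unicyclic graph of Type $I$ with cycle $C$, and let $v\in V(C)$ be such that the pendant tree $G\{v\}$ satisfies $v\notin Supp(G\{v\})$. Then $$\alpha(G)=|Supp(G\{v\})|+|Supp(G-G\{v\})|+\frac{|V(\mathcal{F}_N(G\{v\}))|+|V(\mathcal{F}_N(G-G\{v\}))|}{2}.$$
   Context: All graphs are finite and simple. A unicyclic graph is a connected graph containing exactly one cycle. For a graph $H$ with adjacency matrix $A(H)$, $\mathcal{N}(H)=\{x\in\mathbb{R}^{V(H)}: A(H)x=0\}$ and the support of $H$ is $Supp(H)=\{u\in V(H): x_u\neq 0 \text{ for some } x\in\mathcal{N}(H)\}$. For a subgraph $H$ of $G$, $G-H$ is the subgraph of $G$ induced by $V(G)\setminus V(H)$. $\alpha(G)$ denotes the independence number of $G$ (the maximum cardinality of an independent set). For a unicyclic graph $G$ with cycle $C$ and $v\in V(C)$, the pendant tree $G\{v\}$ of $G$ at $v$ is the induced connected subgraph of $G$ with the maximum possible number of vertices which contains $v$ and no other vertex of $C$ (it may consist of $v$ alone). Note that $G-G\{v\}$ is a tree. The vertex $v$ is called mismatched in $G\{v\}$ if some maximum matching of $G\{v\}$ does not saturate $v$ (if $G\{v\}$ consists of a single vertex, $v$ is mismatched), and matched in $G\{v\}$ otherwise. $G$ is of Type $I$ if some vertex $v\in V(C)$ is matched in $G\{v\}$; otherwise $G$ is of Type $II$. For a tree $T$, the $S$-forest $\mathcal{F}_S(T)$ is the subgraph of $T$ induced by the closed neighborhood $N[Supp(T)]$, i.e. by $Supp(T)$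 together with all neighbors of vertices of $Supp(T)$; the $N$-forest is $\mathcal{F}_N(T)=T-\mathcal{F}_S(T)$. *)

(* Defs.v *)
From HB Require Import structures.
From mathcomp Require Import all_boot all_order all_algebra.
From mathcomp Require Import boolp reals.

Set Implicit Arguments.
Unset Strict Implicit.
Unset Printing Implicit Defensive.

Import Order.TTheory GRing.Theory Num.Theory.
Local Open Scope ring_scope.

Record sgraph := SGraph {
  vertex :> finType;
  adj : rel vertex;
  adj_sym : symmetric adj;
  adj_irr : irreflexive adj
}.

Section Induced.
Variables (G : sgraph) (S : {set G}).

Definition induced_adj : rel {x : G | x \in S} :=
  fun x y => adj (val x) (val y).

Lemma induced_adj_sym : symmetric induced_adj.
Proof. by move=> x y; apply: adj_sym. Qed.

Lemma induced_adj_irr : irreflexive induced_adj.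
Proof. by move=> x; apply: adj_irr. Qed.

Definition induced : sgraph := SGraph induced_adj_sym induced_adj_irr.

End Induced.

Definition connected (G : sgraph) : bool :=
  [forall x : G, forall y : G, connect (@adj G) x y].

Definition is_cycle (G : sgraph) (c : seq G) : bool :=
  (2 < size c)%N && ucycleb (@adj G) c.

Definition cycle_edges (G : sgraph) (c : seq G) : {set {set G}} :=
  [set [set x; next c x] | x in c].

(* A cycle, as a subgraph, is presented by a cyclic enumeration c of its
   vertices; the enumerations of one cycle differ by rotation and reversal, and
   two enumerations present the same subgraph iff they have the same edges. *)
Definition unicyclic (G : sgraph) : Prop :=
  connected G /\
  exists c : seq G, is_cycle c /\
    forall c' : seq G, is_cycle c' -> cycle_edges c' = cycle_edges c.

Definition independent (G : sgraph) (S : {set G}) : bool :=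
  [forall x in S, forall y in S, ~~ adj x y].

Definition alpha (G : sgraph) : nat :=
  (\max_(S : {set G} | independent S) #|S|)%N.

Definition edges (G : sgraph) : {set {set G}} :=
  [set [set p.1; p.2] | p : G * G & adj p.1 p.2].

Definition matching (G : sgraph) (M : {set {set G}}) : bool :=
  (M \subset edges G) && trivIset M.

Definition maximum_matching (G : sgraph) (M : {set {set G}}) : bool :=
  matching M &&
  [forall M' : {set {set G}}, matching M' ==> (#|M'| <= #|M|)%N].

Definition mismatched (G : sgraph) (v : G) : bool :=
  [exists M : {set {set G}}, maximum_matching M && (v \notin cover M)].

Definition matched (G : sgraph) (v : G) : bool := ~~ mismatched v.

Definition adj_mx (R : realType) (G : sgraph) : 'M[R]_#|G| :=
  \matrix_(i, j) (adj (enum_val i) (enum_val j))%:R.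

Definition Supp (R : realType) (G : sgraph) : {set G} :=
  [set u | `[< exists x : 'cV[R]_#|G|,
                 adj_mx R G *m x = 0 /\ x (enum_rank u) 0 <> 0 >]].

Definition closed_nbh (G : sgraph) (S : {set G}) : {set G} :=
  S :|: [set y | [exists x in S, adj x y]].

Definition SForest_set (R : realType) (T : sgraph) : {set T} :=
  closed_nbh (Supp R T).

Definition SForest (R : realType) (T : sgraph) : sgraph :=
  induced (SForest_set R T).

Definition NForest (R : realType) (T : sgraph) : sgraph :=
  induced (~: SForest_set R T).

Section PendantTree.
Variables (G : sgraph) (C : seq G) (v : G).

Definition pendant_cand (S : {set G}) : bool :=
  [&& connected (induced S), v \in S & [forall x in S, (x \in C) ==> (x == v)]].

Definition pendant_set : {set G} :=
  [arg max_(S > [set v] | pendant_cand S) #|S|].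

Lemma pendant_cand1 : pendant_cand [set v].
Proof.
apply/and3P; split; last 2 first.
- by rewrite inE.
- by apply/forall_inP=> x; rewrite inE => ->; apply/implyP.
apply/forallP=> x; apply/forallP=> y.
suff -> : x = y by apply: connect0.
by apply: val_inj; rewrite /= (set1P (valP x)) (set1P (valP y)).
Qed.

Lemma pendant_set_root : v \in pendant_set.
Proof.
rewrite /pendant_set; case: arg_maxnP => [|S /and3P[]//].
exact: pendant_cand1.
Qed.

Definition pendant_tree : sgraph := induced pendant_set.

Definition pendant_root : pendant_tree := exist _ v pendant_set_root.

Definition pendant_compl : sgraph := induced (~: pendant_set).

End PendantTree.

Definition typeI (G : sgraph) (C : seq G) : Prop :=
  exists v : G, v \in C /\ matched (pendant_root C v).

(* Main.v *)
(** Every edge leaving the pendant tree [G{v}] starts at [v], so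
    [alpha G = alpha G{v} + alpha (G - G{v})] as soon as some maximum
    independent set of [G{v}] avoids [v].  Both pieces are acyclic, and for a
    forest [T] two facts are proved together by induction:
    [2 alpha T = 2 |Supp T| + |F_N T|], and every vertex outside [Supp T] is
    avoided by some maximum independent set.  The induction removes a leaf [u]
    and its neighbour [w], taken at the end of a longest path so that all
    neighbours of [w] but one are leaves.  A null vector of [T] vanishes at [w],
    restricts to a null vector of [T - u - w], and its value at [u] is minus the
    sum over the other neighbours of [w]; hence [Supp T] is [Supp (T - u - w)],
    with [u] added exactly when [w] has a neighbour in [Supp (T - u - w)]. *)

Require Import Defs.
From HB Require Import structures.
From mathcomp Require Import all_boot all_order all_algebra.
From mathcomp Require Import boolp reals.

Set Implicit Arguments.
Unset Strict Implicit.
Unset Printing Implicit Defensive.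

Import Order.TTheory GRing.Theory Num.Theory.
Local Open Scope ring_scope.

Definition acyclic (G : sgraph) : Prop := forall c : seq G, ~~ is_cycle c.

(** * Independence number relative to a vertex set *)

Section IndependenceIn.
Variable G : sgraph.
Implicit Types (U I J : {set G}) (u v w x y : G).

(** Working relative to a vertex set of a fixed graph lets the induction delete vertices without
    changing the vertex type. *)
Definition alpha_in U : nat :=
  (\max_(I : {set G} | independent I && (I \subset U)) #|I|)%N.

Lemma alpha_inT : alpha_in [set: G] = alpha G.
Proof. by apply: eq_bigl => I; rewrite subsetT andbT. Qed.

Lemma leq_alpha_in U I : independent I -> I \subset U -> (#|I| <= alpha_in U)%N.
Proof. by move=> iI sI; apply: leq_bigmax_cond; rewrite iI. Qed.

Lemma independent0 : independent (set0 : {set G}).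
Proof. by apply/forall_inP => x; rewrite inE. Qed.

Lemma alpha_in_max U :
  exists I, [/\ independent I, I \subset U & #|I| = alpha_in U].
Proof.
have [|I /andP[iI sI] e] := @eq_bigmax_cond _
  [pred I : {set G} | independent I && (I \subset U)] (fun I => #|I|).
  by apply/card_gt0P; exists set0; rewrite inE independent0 sub0set.
by exists I.
Qed.

Lemma alpha_in_leq U n :
  (forall I, independent I -> I \subset U -> (#|I| <= n)%N) ->
  (alpha_in U <= n)%N.
Proof. by move=> h; apply/bigmax_leqP => I /andP[]; apply: h. Qed.

Lemma independentP I :
  reflect {in I &, forall x y, ~~ adj x y} (independent I).
Proof.
apply: (iffP forall_inP) => h x; first by move=> y xI yI; apply: (forall_inP (h x xI)).
by move=> xI; apply/forall_inP => y; apply: h.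
Qed.

Lemma independentS I J : I \subset J -> independent J -> independent I.
Proof.
move=> /subsetP s /independentP h; apply/independentP => x y xI yI.
by apply: h; apply: s.
Qed.

Lemma independentU1 u I :
  independent I -> {in I, forall y, ~~ adj u y} -> independent (u |: I).
Proof.
move=> /independentP iI h; apply/independentP => x y.
rewrite !inE => /predU1P[-> | xI] /predU1P[-> | yI].
- by rewrite adj_irr.
- exact: h.
- by rewrite adj_sym h.
- exact: iI.
Qed.

Lemma alpha_in_isolated U u : u \in U -> {in U, forall y, ~~ adj u y} ->
  alpha_in U = (alpha_in (U :\ u)).+1.
Proof.
move=> uU hu; apply/eqP; rewrite eqn_leq; apply/andP; split.
  apply: alpha_in_leq => I iI sI; rewrite (cardsD1 u I) -add1n leq_add ?leq_b1 //.
  by rewrite leq_alpha_in ?setSD // (independentS _ iI) // subD1set.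
have [I [iI sI <-]] := alpha_in_max (U :\ u).
have uI : u \notin I by apply/negP => /(subsetP sI); rewrite !inE eqxx.
have sIU : I \subset U by apply: subset_trans sI (subD1set _ _).
have <- : #|u |: I| = #|I|.+1 by rewrite cardsU1 uI.
apply: leq_alpha_in; last by rewrite subUset sub1set uU.
by apply: independentU1 => // y /(subsetP sIU); apply: hu.
Qed.

(** An independent set contains at most one of the adjacent vertices [u] and [w]. Conversely [u] can
    be added to any independent set inside [U :\ u :\ w], since its only neighbour in [U] has been
    removed. *)
Lemma alpha_in_leaf U u w : u \in U -> w \in U -> adj u w ->
  {in U, forall y, adj u y -> y = w} ->
  alpha_in U = (alpha_in (U :\ u :\ w)).+1.
Proof.
move=> uU wU uw hu; apply/eqP; rewrite eqn_leq; apply/andP; split.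
  apply: alpha_in_leq => I iI sI.
  have h : (#|I| <= 1 + #|I :\ u :\ w|)%N.
    rewrite (cardsD1 u I) (cardsD1 w (I :\ u)) addnA leq_add2r !inE.
    case uI: (u \in I); last by rewrite leq_b1.
    case wI: (w \in I); last by rewrite andbF.
    by move/independentP: iI => /(_ u w uI wI); rewrite uw.
  apply: leq_trans h _; rewrite add1n ltnS leq_alpha_in ?setSD //.
  by rewrite (independentS _ iI) ?(subset_trans (subD1set _ _)) ?subD1set.
have [I [iI sI <-]] := alpha_in_max (U :\ u :\ w).
have uI : u \notin I by apply/negP => /(subsetP sI); rewrite !inE eqxx andbF.
have <- : #|u |: I| = #|I|.+1 by rewrite cardsU1 uI.
have sIU : I \subset U.
  by apply: subset_trans sI _; rewrite (subset_trans (subD1set _ _)) ?subD1set.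
apply: leq_alpha_in; last by rewrite subUset sub1set uU.
apply: independentU1 => // y yI; apply/negP => /(hu _ (subsetP sIU _ yI)) yw.
by move/(subsetP sI): yI; rewrite !inE yw eqxx.
Qed.

End IndependenceIn.

(** * Leaves at the end of a longest path *)

Section Leaves.
Variable G : sgraph.
Hypothesis acG : acyclic G.
Implicit Types (U : {set G}) (u v w x y : G).

(** If [y] came after the head of [s], the segment of the path from [x] to [y], closed by the edge
    from [y] to [x], would be a cycle. *)
Lemma acyclic_chord x s y : path (@adj G) x s -> uniq (x :: s) ->
  y \in s -> adj x y -> y = head x s.
Proof.
case: s => [//|x1 s] /= /andP[xx1 ps] /and3P[xs x1s us].
rewrite in_cons => /predU1P[-> //|ys] xy.
case: (splitPr ys) ps xs x1s us => a b.
rewrite cat_path /= !inE !mem_cat !inE => /and3P[pa ay _] xs x1s us.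
have /negP[] := acG [:: x, x1 & rcons a y].
rewrite /is_cycle /= size_rcons /ucycleb /= xx1 !rcons_path last_rcons pa ay.
rewrite adj_sym xy /= !inE !mem_rcons !inE rcons_uniq.
move: xs x1s us; rewrite !negb_or cat_uniq /= => /and3P[-> -> /andP[-> _]].
move=> /and3P[-> -> _] /= /and3P[-> h _] /=.
by move: h; rewrite negb_or => /andP[-> _].
Qed.

Lemma longest_path U : U != set0 -> exists x s,
  [/\ path (@adj G) x s, uniq (x :: s), all (mem U) (x :: s) &
   forall s', sorted (@adj G) s' -> uniq s' -> all (mem U) s' ->
     (size s' <= (size s).+1)%N].
Proof.
move=> /set0Pn[x0 x0U].
(* Tuples make the property boolean, as [ex_maxnP] requires; a list without repetition has at most
   [#|G|] entries, which bounds [n]. *)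
pose P n := [exists t : n.-tuple G,
  [&& sorted (@adj G) t, uniq t & all (mem U) t]].
have P1 : P 1%N by apply/existsP; exists [tuple x0]; rewrite /= x0U.
have Pb n : P n -> (n <= #|G|)%N.
  move=> /existsP[t /and3P[_ ut _]].
  by rewrite -(size_tuple t) -(card_uniqP ut) max_card.
have [n Pn nmax] := ex_maxnP (ex_intro (fun n => P n) _ P1) Pb.
move: (nmax _ P1) => n0; case: n n0 Pn nmax => // n _ /existsP[[t /= /eqP st]].
case: t st => [//|x s] [sn] /and3P[h1 h2 h3] nmax; exists x, s; split=> // s'.
move=> h1' h2' h3'; rewrite sn; apply: nmax; apply/existsP.
by exists (in_tuple s'); rewrite /= h1' h2'.
Qed.

(* [u], [w] and [z] are the first three vertices of a longest path. *)
Lemma acyclic_pendant_star U : U != set0 ->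
  (exists2 u, u \in U & {in U, forall y, ~~ adj u y}) \/
  exists u w z, [/\ u \in U, w \in U, adj u w,
    {in U, forall y, adj u y -> y = w} &
    {in U, forall y, adj w y -> y != u -> y != z ->
       {in U, forall t, adj y t -> t = w}}].
Proof.
move=> /longest_path[x0 [s [ps us aU smax]]].
(* A neighbour of the first vertex off the path would prolong a longest path, and one on the path
   must be the second vertex. The claim covers every path of maximal length because it is applied
   again with the first vertex replaced by another neighbour of the second. *)
have nbr x t : path (@adj G) x t -> uniq (x :: t) -> all (mem U) (x :: t) ->
    size t = size s -> {in U, forall y, adj x y -> y = head x t}.
  move=> pt ut aU' st y yU xy; apply: (acyclic_chord pt ut) => //.
  apply/negPn/negP => yt.
  have := smax [:: y, x & t]; rewrite /= st ltnn adj_sym xy pt yU.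
  move: ut aU' => /= /andP[-> ->] /andP[-> ->]; rewrite !inE negb_or yt !andbT.
  have -> : y != x by apply: contraTneq xy => ->; rewrite adj_irr.
  by move=> /(_ isT isT isT).
case: s ps us aU smax nbr => [|x1 s] ps us aU smax nbr.
  left; exists x0; first by case/andP: aU.
  move=> y yU; apply/negP => xy.
  (* The longest path is a single vertex, so [head] returns its default [x0] and a neighbour of [x0]
     would be [x0] itself. *)
  by have /= e := nbr _ _ ps us aU erefl y yU xy; rewrite e adj_irr in xy.
have /= nb0 := nbr _ _ ps us aU erefl.
case/and3P: (aU) => x0U x1U sU; case/andP: (ps) => x01 p1.
have u1 : uniq (x1 :: s) by move: us; rewrite cons_uniq => /andP[].
(* On a path of two vertices the third one defaults to [x1], which excludes no neighbour of [x1].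
   Otherwise a neighbour [y] as given lies off the path, and [y :: x1 :: s] is again a longest
   path. *)
right; exists x0, x1, (head x1 s); split=> // y yU x1y yx0 yz.
have ys : y \notin s.
  by apply: contraNN yz => /(acyclic_chord p1 u1)/(_ x1y) ->.
apply: (nbr y (x1 :: s)) => //; first by rewrite /= adj_sym x1y.
- rewrite cons_uniq u1 inE negb_or ys !andbT.
  by apply: contraTneq x1y => ->; rewrite adj_irr.
- by move: aU; rewrite /= yU => /andP[_ ->].
Qed.

End Leaves.

(** * Null vectors and support relative to a vertex set *)

Section Support.
Variables (R : realType) (G : sgraph).
Implicit Types (U : {set G}) (u v w x y : G) (f g : G -> R).

(** This is the kernel of the adjacency matrix of the subgraph induced by [U], encoded by functions
    on all of [G] whose values outside [U] are free. *)
Definition null_in U f : Prop :=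
  {in U, forall u, \sum_(y in U | adj u y) f y = 0}.

Definition supp_in U : {set G} :=
  [set u in U | `[< exists f, null_in U f /\ f u <> 0 >]].

Lemma supp_inP U u :
  reflect (u \in U /\ exists f, null_in U f /\ f u <> 0) (u \in supp_in U).
Proof. by rewrite inE; apply: (iffP andP) => -[uU /asboolP]. Qed.

Lemma adj_mx_mulE (x : 'cV[R]_#|G|) i : (adj_mx R G *m x) i 0 =
  \sum_(y in [set: G] | adj (enum_val i) y) x (enum_rank y) 0.
Proof.
rewrite mxE (reindex (@enum_val G G)) /=; last first.
  by apply: onW_bij; apply: enum_val_bij.
rewrite [RHS]big_mkcond; apply: eq_bigr => j _; rewrite mxE inE /= enum_valK.
by case: adj; rewrite (mul1r, mul0r).
Qed.

Lemma supp_inT : supp_in [set: G] = Supp R G.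
Proof.
apply/setP => u; apply/supp_inP/idP => [[_ [f [nf fu]]]|].
  rewrite inE; apply/asboolP; exists (\col_i f (enum_val i)).
  split; last by rewrite mxE enum_rankK.
  apply/colP => i; rewrite adj_mx_mulE [RHS]mxE -[RHS](nf (enum_val i)) ?inE //.
  by apply: eq_bigr => y _; rewrite mxE enum_rankK.
rewrite inE => /asboolP[x [Ax xu]]; split; first by rewrite inE.
exists (fun y => x (enum_rank y) 0); split=> // y _.
by rewrite -(enum_rankK y) -adj_mx_mulE Ax mxE.
Qed.

Lemma null_in_delta U u : {in U, forall y, ~~ adj u y} ->
  null_in U (fun y => (y == u)%:R).
Proof.
move=> hu t tU; apply: big1 => y /andP[yU ty].
case: eqP => // yu; rewrite yu adj_sym in ty.
by rewrite (negPf (hu t tU)) in ty.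
Qed.

Lemma supp_in_isolated U u : u \in U -> {in U, forall y, ~~ adj u y} ->
  supp_in U = u |: supp_in (U :\ u).
Proof.
move=> uU hu.
(* An isolated vertex occurs in no equation, and its own equation is an empty sum. *)
have nE f : null_in U f <-> null_in (U :\ u) f.
  have E t : t \in U ->
      \sum_(y in U | adj t y) f y = \sum_(y in U :\ u | adj t y) f y.
    move=> tU; apply: eq_bigl => y; rewrite !inE; case: eqP => //= ->.
    by rewrite adj_sym (negPf (hu t tU)) andbF.
  split=> nf t tU; first by case/setD1P: (tU) => _ tU'; rewrite -E // nf.
  rewrite E //; have [-> | tu] := eqVneq t u; last by rewrite nf // !inE tu.
  by apply: big1 => y /andP[/setD1P[_ yU]]; rewrite (negPf (hu y yU)).
apply/setP => t; rewrite in_setU1; have [-> | tu] /= := eqVneq t u.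
  apply/supp_inP; split=> //; exists (fun y => (y == u)%:R).
  by split; [exact: null_in_delta | rewrite eqxx; apply/eqP/oner_neq0].
by apply/supp_inP/supp_inP; rewrite !inE tu /= => -[tU [f [/nE nf ft]]];
  split=> //; exists f.
Qed.

(** * Deletion of a leaf and its neighbour *)

Section Leaf.
Variables (U : {set G}) (u w : G).
Hypotheses (uU : u \in U) (wU : w \in U) (uw : adj u w).
Hypothesis hu : {in U, forall y, adj u y -> y = w}.
Let U' := U :\ u :\ w.

Lemma sum_adj_leaf f t : t \in U -> \sum_(y in U | adj t y) f y =
  (adj t u)%:R * f u + (adj t w)%:R * f w + \sum_(y in U' | adj t y) f y.
Proof.
move=> tU.
have wu : w != u by apply: contraTneq uw => ->; rewrite adj_irr.
rewrite !big_mkcondr /= (bigD1 u) //= -addrA; congr (_ + _).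
  by case: adj; rewrite (mul1r, mul0r).
rewrite (bigD1 w) ?wU //=; congr (_ + _).
  by case: adj; rewrite (mul1r, mul0r).
by apply: eq_bigl => y; rewrite !inE andbC [_ && (y != u)]andbC.
Qed.

(** The equation at the leaf [u] says [f w = 0], and the one at [w] determines [f u]. At the other
    vertices the term of [u] is absent and that of [w] is zero, so their equations are those of
    [U']. *)
Lemma null_in_leaf f : null_in U f <->
  [/\ null_in U' f, f w = 0 & f u = - \sum_(y in U' | adj w y) f y].
Proof.
have U'P t : t \in U' -> [/\ t \in U, t != u & t != w].
  by rewrite !inE => /and3P[].
have nu : \sum_(y in U' | adj u y) f y = 0.
  rewrite big1 // => y /andP[/U'P[yU _ yw]] /(hu yU) e.
  by rewrite e eqxx in yw.
have tu t : t \in U' -> adj t u = false.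
  move=> /U'P[tU _ tw]; rewrite adj_sym; apply: contraNF tw => /(hu tU) ->.
  by rewrite eqxx.
split=> [nf | [nf fw fu] t tU].
  have fw : f w = 0.
    have := nf u uU.
    by rewrite sum_adj_leaf // nu adj_irr uw mul0r mul1r add0r addr0.
  split=> // [t tU'|].
    case/U'P: (tU') => tU _ _; rewrite -[RHS](nf t tU) sum_adj_leaf //.
    by rewrite fw mulr0 tu // mul0r !add0r.
  have := nf w wU; rewrite sum_adj_leaf // adj_irr adj_sym uw mul0r addr0 mul1r.
  by move/eqP; rewrite addr_eq0 => /eqP.
rewrite sum_adj_leaf // fw mulr0 addr0.
have [-> | ntu] := eqVneq t u; first by rewrite adj_irr mul0r add0r.
have [-> | ntw] := eqVneq t w; first by rewrite adj_sym uw mul1r fu addNr.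
have tU' : t \in U' by rewrite !inE ntu ntw.
by rewrite tu // mul0r add0r nf.
Qed.

Lemma null_in_leaf_extend f : null_in U' f ->
  exists2 g, null_in U g & {in U', g =1 f} /\
    g u = - \sum_(y in U' | adj w y) f y.
Proof.
move=> nf.
have wu : w != u by apply: contraTneq uw => ->; rewrite adj_irr.
pose g y := if y == u then - \sum_(y in U' | adj w y) f y
            else if y == w then 0 else f y.
have gf : {in U', g =1 f}.
  by move=> y; rewrite !inE /g => /and3P[/negPf-> /negPf-> _].
have gE t : \sum_(y in U' | adj t y) g y = \sum_(y in U' | adj t y) f y.
  by apply: eq_bigr => y /andP[/gf].
exists g; last by rewrite /g eqxx.
apply/null_in_leaf; split; first by move=> t tU'; rewrite gE nf.
- by rewrite /g (negPf wu) eqxx.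
- by rewrite gE /g eqxx.
Qed.

Lemma supp_in_leafD : supp_in U :\ u = supp_in U'.
Proof.
apply/setP => t; rewrite in_setD1.
apply/andP/supp_inP => [[tu /supp_inP[tU [f [/null_in_leaf[nf fw _] ft]]]]|].
  have tw : t != w by apply/eqP => tw; rewrite tw in ft.
  by split; [rewrite !inE tu tw | exists f].
move=> [tU' [f [nf ft]]].
have /and3P[tw tu tU] : [&& t != w, t != u & t \in U].
  by move: tU'; rewrite !inE.
split=> //.
apply/supp_inP; split=> //.
have [g ng [gf _]] := null_in_leaf_extend nf.
by exists g; split=> //; rewrite gf.
Qed.

Lemma supp_in_leaf_nbr : u \in supp_in U -> exists2 y, y \in supp_in U' & adj w y.
Proof.
move=> /supp_inP[_ [f [/null_in_leaf[nf _ fu] fu0]]].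
have [y /and3P[yU' wy fy]|no] := pickP [pred y | [&& y \in U', adj w y & f y != 0]].
  by exists y => //; apply/supp_inP; split=> //; exists f; split=> //; apply/eqP.
case: fu0; rewrite fu big1 ?oppr0 // => y /andP[yU' wy].
by have /negbT := no y; rewrite /= yU' wy /= negbK => /eqP.
Qed.

Variable z : G.
Hypothesis hw : {in U, forall y, adj w y -> y != u -> y != z ->
       {in U, forall t, adj y t -> t = w}}.

Lemma leaf_nbr_isolated y : y \in U' -> adj w y -> y != z ->
  {in U', forall t, ~~ adj y t}.
Proof.
rewrite !inE => /and3P[yw yu yU] wy yz t; rewrite !inE => /and3P[tw tu tU].
by apply: contraNN tw => yt; rewrite (hw yU wy yu yz tU yt).
Qed.

(** What is needed is a null vector of [U'] whose sum over the neighbours of [w] does not cancel. A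
    neighbour other than [z] is isolated in [U'], and its indicator serves; if there is none, the
    sum has a single term, the nonzero value at [y]. *)
Lemma nbr_supp_in_leaf y : y \in supp_in U' -> adj w y -> u \in supp_in U.
Proof.
move=> yS wy.
suff [f nf sf] : exists2 f, null_in U' f & \sum_(y in U' | adj w y) f y <> 0.
  have [g ng [_ gu]] := null_in_leaf_extend nf.
  apply/supp_inP; split=> //; exists g; split=> //; rewrite gu => /eqP.
  by rewrite oppr_eq0 => /eqP.
have [yU' [f [nf fy]]] := supp_inP _ _ yS.
have [t /and3P[tU' wt tz]|no] := pickP [pred t | [&& t \in U', adj w t & t != z]].
  exists (fun y => (y == t)%:R).
    by apply: null_in_delta; apply: leaf_nbr_isolated.
  rewrite (bigD1 t) ?tU' //= eqxx big1 ?addr0 => [|s /andP[_ /negPf->//]].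
  exact/eqP/oner_neq0.
have eqz t : t \in U' -> adj w t -> t = z.
  by move=> tU' wt; have /negbT := no t; rewrite /= tU' wt negbK => /eqP.
exists f => //; rewrite (bigD1 y) ?yU' //= big1 ?addr0 // => t.
by move=> /andP[/andP[tU' wt]]; rewrite (eqz t) // (eqz y) ?eqxx.
Qed.

End Leaf.

End Support.

(** * Independence number and support of a forest *)

Section ForestIndependence.
Variables (R : realType) (G : sgraph).
Implicit Types (U I S : {set G}) (u v w x y : G).

Lemma in_closed_nbh S y :
  (y \in closed_nbh S) = (y \in S) || [exists x in S, adj x y].
Proof. by rewrite !inE. Qed.

Lemma acyclic_alpha_in U : acyclic G ->
  (alpha_in U).*2 = (#|supp_in R U|.*2 + #|U :\: closed_nbh (supp_in R U)|)%N
  /\ {in U, forall v, v \notin supp_in R U -> exists I,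
       [/\ independent I, I \subset U, #|I| = alpha_in U & v \notin I]}.
Proof.
move=> acG; have [n] := ubnP #|U|; elim: n U => // n IHn U; rewrite ltnS => Un.
have [-> | Un0] := eqVneq U set0.
  split; last by move=> v; rewrite inE.
  have -> : supp_in R set0 = set0 :> {set G} by apply/setP => y; rewrite !inE.
  have -> : alpha_in (set0 : {set G}) = 0%N.
    apply/eqP; rewrite -leqn0; apply: alpha_in_leq => I _.
    by rewrite subset0 => /eqP->; rewrite cards0.
  by rewrite set0D !cards0.
have [[u uU hu] | [u [w [z [uU wU uw hu hw]]]]] := acyclic_pendant_star acG Un0.
  have [|IH1 IH2] := IHn (U :\ u); first by rewrite [#|U|](cardsD1 u) uU in Un.
  have uS : u \notin supp_in R (U :\ u) by rewrite inE in_setD1 eqxx.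
  rewrite (alpha_in_isolated uU hu) (supp_in_isolated R uU hu).
  split; last first.
    move=> v vU; rewrite in_setU1 negb_or => /andP[vu vS].
    have [|I [iI sI cI vI]] := IH2 v _ vS; first by rewrite in_setD1 vu.
    have uI : u \notin I by apply/negP => /(subsetP sI); rewrite !inE eqxx.
    have sIU : I \subset U by apply: subset_trans sI (subD1set _ _).
    exists (u |: I); split.
    - by apply: independentU1 => // y /(subsetP sIU); apply: hu.
    - by rewrite subUset sub1set uU.
    - by rewrite cardsU1 uI cI.
    - by rewrite in_setU1 negb_or vu.
  (* The isolated [u] joins the support and brings no other vertex of [U] into its closed
     neighbourhood, so the N-forest keeps its vertices. *)
  rewrite cardsU1 uS add1n !doubleS IH1 !addSn; congr (_ + _).+2%N.
  congr #|pred_of_set _|; apply/setP => y.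
  rewrite !in_setD in_set1 !in_closed_nbh in_setU1.
  have [-> | yu] /= := eqVneq y u; first by rewrite andbF.
  case yU: (y \in U); rewrite ?andbF //= !andbT; congr (~~ (_ || _)).
  apply/exists_inP/exists_inP => -[t tS ty]; exists t => //.
    by rewrite in_setU1 tS orbT.
  by case/setU1P: tS ty => // ->; rewrite (negPf (hu y yU)).
set U' := U :\ u :\ w.
have wu : w != u by apply: contraTneq uw => ->; rewrite adj_irr.
have cU : #|U| = #|U'|.+2.
  by rewrite (cardsD1 u) uU (cardsD1 w) in_setD1 wu wU.
have U'P t : (t \in U') = [&& t != w, t != u & t \in U] by rewrite !inE.
have [|IH1 IH2] := IHn U'; first by rewrite cU in Un; apply: ltnW.
have SU' y : y \in supp_in R U' -> y \in U' by case/supp_inP.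
have sU'U : U' \subset U by apply/subsetP => t; rewrite U'P => /and3P[].
have extI I : independent I -> I \subset U' ->
    [/\ independent (u |: I), u |: I \subset U & #|u |: I| = #|I|.+1].
  move=> iI sI; have uI : u \notin I.
    by apply/negP => /(subsetP sI); rewrite U'P eqxx andbF.
  split; last by rewrite cardsU1 uI.
  - apply: independentU1 => // y /(subsetP sI); rewrite U'P => /and3P[yw _ yU].
    by apply: contraNN yw => /(hu y yU) ->.
  - by rewrite subUset sub1set uU (subset_trans sI).
have wS : w \notin supp_in R U.
  apply/supp_inP => -[_ [f [nf]]].
  by have [_ ->] := (null_in_leaf uU wU uw hu f).1 nf.
have aU := alpha_in_leaf uU wU uw hu; rewrite -/U' in aU.
have SD := supp_in_leafD R uU wU uw hu; rewrite -/U' in SD.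
(* Add [u] to a maximum independent set of [U'] missing [v]: for [v = w] every such set does, and
   otherwise [v] is outside the support of [U'] and the induction hypothesis applies. *)
have avoid v : v \in U -> v != u -> v \notin supp_in R U -> exists I,
    [/\ independent I, I \subset U, #|I| = alpha_in U & v \notin I].
  move=> vU vu vS.
  have [I [iI sI cI vI]] : exists I,
    [/\ independent I, I \subset U', #|I| = alpha_in U' & v \notin I].
    have [-> | vw] := eqVneq v w.
      have [I [iI sI cI]] := alpha_in_max U'; exists I; split=> //.
      by apply/negP => /(subsetP sI); rewrite U'P eqxx.
    by apply: IH2; rewrite ?U'P ?vw ?vu // -SD in_setD1 negb_and vS orbT.
  have [h1 h2 h3] := extI I iI sI; exists (u |: I); split=> //.
    by rewrite h3 cI aU.
  by rewrite in_setU1 negb_or vu.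
have adju y : y \in U -> adj y u -> y = w by move=> yU; rewrite adj_sym; apply: hu.
have [uS | uS] := boolP (u \in supp_in R U).
  have [y yS wy] := supp_in_leaf_nbr uU wU uw hu uS; rewrite -/U' in yS.
  have SE : supp_in R U = u |: supp_in R U' by rewrite -SD setD1K.
  split; last by move=> v vU vS; apply: avoid => //; apply: contraNneq vS => ->.
  (* The increase comes from [u] joining the support. Both [u] and [w] lie in the closed
     neighbourhood, and [u] has no other neighbour in [U], so the N-forest keeps its vertices. *)
  rewrite aU (cardsD1 u (supp_in R U)) uS SD add1n !doubleS IH1 !addSn.
  congr (_ + _).+2%N.
  congr #|pred_of_set _|; apply/setP => t.
  rewrite !(in_setD _ (closed_nbh _)) U'P !in_closed_nbh SE in_setU1.
  have [-> | tu] //= := eqVneq t u; first by rewrite !andbF.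
  have [-> | tw] /= := eqVneq t w.
    rewrite andbF; symmetry; apply/negbTE; rewrite negb_and negbK.
    by apply/orP; left; apply/orP; right; apply/exists_inP; exists u; rewrite ?setU11.
  case tU: (t \in U); rewrite ?andbF //= !andbT; congr (~~ (_ || _)).
  apply/exists_inP/exists_inP => -[s sS st]; exists s => //.
    by rewrite in_setU1 sS orbT.
  by case/setU1P: sS st => // -> /(hu t tU) e; rewrite e eqxx in tw.
have SE : supp_in R U = supp_in R U'.
  by rewrite -SD; apply/setP => t; rewrite in_setD1; case: eqP => // ->; apply/negbTE.
have wN y : y \in supp_in R U' -> ~~ adj w y.
  by move=> yS; apply: contraNN uS; apply: (nbr_supp_in_leaf uU wU uw hu hw yS).
split.
  (* The support is unchanged and the N-forest gains exactly [u] and [w]: neither is in the support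
     or adjacent to it. *)
  rewrite aU SE doubleS IH1 -2!addnS; congr (_ + _)%N.
  have uB : u \in U :\: closed_nbh (supp_in R U').
    rewrite in_setD in_closed_nbh uU andbT -SE negb_or uS SE /=.
    apply/exists_inP => -[s sS /adju e]; move: (SU' s sS); rewrite U'P.
    by case/and3P=> sw _ sU; rewrite e ?eqxx in sw.
  have wB : w \in (U :\: closed_nbh (supp_in R U')) :\ u.
    rewrite in_setD1 wu in_setD in_closed_nbh wU andbT -SE negb_or wS SE /=.
    by apply/exists_inP => -[s sS]; rewrite adj_sym (negPf (wN s sS)).
  rewrite [RHS](cardsD1 u) uB [in RHS](cardsD1 w) wB !add1n; congr _.+2.
  congr #|pred_of_set _|; apply/setP => t.
  by rewrite !in_setD !in_set1 andbCA; congr (_ && _); apply: andbCA.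
move=> v vU vS; have [vu | vu] := eqVneq v u; last exact: avoid.
(* To avoid [u], take [w] instead, which needs a maximum independent set of [U'] free of neighbours
   of [w]. A neighbour other than [z] would be isolated in [U'], hence in the support, against [wN];
   and [z], if adjacent to [w], is outside the support, so the induction hypothesis avoids it. *)
have [I [iI sI cI wI]] : exists I, [/\ independent I, I \subset U',
    #|I| = alpha_in U' & {in I, forall y, ~~ adj w y}].
  have eqz y : y \in U' -> adj w y -> y = z.
    move=> yU' wy; apply/eqP/negPn/negP => yz.
    have iy := leaf_nbr_isolated hw yU' wy yz.
    suff /wN : y \in supp_in R U' by rewrite wy.
    by rewrite (supp_in_isolated R yU' iy) setU11.
  have [/andP[zU' wz] | nz] := boolP ((z \in U') && adj w z).
    have [|I [iI sI cI zI]] := IH2 z zU'.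
      by apply: contraTN wz => /wN.
    exists I; split=> // y yI; apply/negP => /(eqz y (subsetP sI y yI)) yz.
    by rewrite -yz yI in zI.
  have [I [iI sI cI]] := alpha_in_max U'; exists I; split=> // y yI.
  have yU' := subsetP sI y yI; apply: contraNN nz => wy.
  by rewrite -(eqz y yU' wy) yU' wy.
have wnI : w \notin I by apply/negP => /(subsetP sI); rewrite U'P eqxx.
exists (w |: I); split.
- exact: independentU1.
- by rewrite subUset sub1set wU (subset_trans sI).
- by rewrite cardsU1 wnI cI aU.
- rewrite vu in_setU1 negb_or eq_sym wu; apply/negP => /(subsetP sI).
  by rewrite U'P eqxx andbF.
Qed.

End ForestIndependence.

(** * Transfer to induced subgraphs *)

Section InducedSubgraph.
Variables (G : sgraph) (U : {set G}).

Lemma is_cycle_map_val (c : seq (induced U)) : is_cycle (map val c) = is_cycle c.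
Proof.
rewrite /is_cycle /ucycleb size_map (map_inj_uniq val_inj); congr (_ && (_ && _)).
by case: c => //= x c; rewrite -map_rcons path_map.
Qed.

Lemma acyclic_induced :
  (forall c : seq G, is_cycle c -> ~~ all (mem U) c) -> acyclic (induced U).
Proof.
move=> h c; rewrite -is_cycle_map_val; apply/negP => /h/negP[].
by apply/allP => _ /mapP[x _ ->]; apply: valP.
Qed.

Lemma independent_imset_val (I : {set induced U}) :
  independent (val @: I) = independent I.
Proof.
apply/independentP/independentP => h x y; last first.
  by move=> /imsetP[x' x'I ->] /imsetP[y' y'I ->]; apply: h.
by move=> xI yI; apply: (h (val x) (val y)); apply: imset_f.
Qed.

Lemma imset_val_sub (I : {set induced U}) : val @: I \subset U.
Proof. by apply/subsetP => _ /imsetP[x _ ->]; apply: valP. Qed.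

Lemma alpha_induced : alpha (induced U) = alpha_in U.
Proof.
rewrite -alpha_inT; apply/eqP; rewrite eqn_leq; apply/andP; split.
  apply: alpha_in_leq => I iI _; rewrite -(card_imset _ val_inj).
  by rewrite leq_alpha_in ?independent_imset_val // imset_val_sub.
apply: alpha_in_leq => I iI sI.
have E : I = val @: [set x : induced U | val x \in I].
  apply/setP => x; apply/idP/imsetP => [xI | [y]]; last by rewrite inE => yI ->.
  by exists (exist _ x (subsetP sI x xI)); rewrite ?inE.
rewrite E card_imset; last exact: val_inj.
by apply: leq_alpha_in; rewrite ?subsetT // -independent_imset_val -E.
Qed.

End InducedSubgraph.

(** * The forest results for a whole graph *)

Section Forest.
Variables (R : realType) (T : sgraph).
Hypothesis acT : acyclic T.

Lemma card_NForest : #|NForest R T| = #|~: SForest_set R T|.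
Proof. by rewrite card_sig; apply: eq_card => x; rewrite !inE. Qed.

Lemma acyclic_alpha : (alpha T).*2 = (#|Supp R T|.*2 + #|NForest R T|)%N.
Proof.
have [] := acyclic_alpha_in R [set: T] acT; rewrite alpha_inT supp_inT => -> _.
by rewrite card_NForest -setTD.
Qed.

Lemma acyclic_max_independent_avoid v : v \notin Supp R T ->
  exists I : {set T}, [/\ independent I, #|I| = alpha T & v \notin I].
Proof.
rewrite -supp_inT => vS; have [_ h] := acyclic_alpha_in R [set: T] acT.
by have [I [? _ cI ?]] := h v (in_setT _) vS; exists I; rewrite -alpha_inT.
Qed.

End Forest.

(** * Splitting a unicyclic graph at a pendant tree *)

Section Unicyclic.
Variables (G : sgraph) (C : seq G).
Hypotheses (hG : unicyclic G) (hC : is_cycle C).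

Lemma cover_cycle_edges (c : seq G) x : (x \in cover (cycle_edges c)) = (x \in c).
Proof.
apply/bigcupP/idP => [[_ /imsetP[y yc ->]] | xc].
  by rewrite !inE => /orP[] /eqP->; rewrite ?mem_next.
by exists [set x; next c x]; [apply/imsetP; exists x | apply: setU11].
Qed.

(** Uniqueness of the cycle is an equality of edge sets; the vertices are recovered as the cover of
    the edges. *)
Lemma unicyclic_mem_cycle (c : seq G) : is_cycle c -> c =i C.
Proof.
case: hG => _ [c0 [_ h]] hc x.
by rewrite -!cover_cycle_edges (h c hc) (h C hC).
Qed.

Variable v : G.
Hypothesis hv : v \in C.

Lemma pendant_setP : pendant_cand C v (pendant_set C v) /\
  forall S, pendant_cand C v S -> (#|S| <= #|pendant_set C v|)%N.
Proof. by rewrite /pendant_set; case: arg_maxnP => //; apply: pendant_cand1. Qed.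

Lemma pendant_set_cycle x : x \in pendant_set C v -> x \in C -> x = v.
Proof.
have [/and3P[_ _ /forall_inP h] _] := pendant_setP.
by move=> xP xC; have := h x xP; rewrite xC => /eqP.
Qed.

(** A cycle inside the tree would have all its vertices on [C], hence all equal to [v], yet it has
    at least three distinct ones. *)
Lemma acyclic_pendant_tree : acyclic (pendant_tree C v).
Proof.
apply: acyclic_induced => c hc; apply/negP => /allP cP.
have {}cP x : x \in c -> x = v.
  by move=> xc; apply: pendant_set_cycle (cP x xc) _; rewrite -(unicyclic_mem_cycle hc).
case/andP: hc => sc /andP[_ uc]; case: c sc uc cP => [|a [|b c]] //= _ uc cP.
have av : a = v by apply: cP; rewrite inE eqxx.
have bv : b = v by apply: cP; rewrite !inE eqxx orbT.
by move: uc; rewrite av bv inE eqxx.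
Qed.

(** Every cycle of [G] passes through [v], which the complement omits. *)
Lemma acyclic_pendant_compl : acyclic (pendant_compl C v).
Proof.
apply: acyclic_induced => c hc; apply/negP => /allP/(_ v).
by rewrite (unicyclic_mem_cycle hc) hv /= in_setC pendant_set_root => /(_ isT).
Qed.

(** This enlarges a candidate for the pendant tree by one vertex, to contradict its maximality. *)
Lemma connected_setU1 (S : {set G}) x y : connected (induced S) ->
  x \in S -> adj x y -> connected (induced (y |: S)).
Proof.
move=> /forallP cS xS xy.
have SS' t : t \in S -> t \in y |: S by move=> tS; rewrite in_setU1 tS orbT.
pose f (t : induced S) : induced (y |: S) := exist _ (val t) (SS' _ (valP t)).
have cf a b : connect (@adj (induced (y |: S))) (f a) (f b).
  have /forallP/(_ b)/connectP[p pp ->] := cS a.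
  elim: p a pp => [|c p IH] a //= /andP[ac pc].
  by apply: connect_trans (IH c pc); apply: connect1.
have yS' : y \in y |: S by apply: setU11.
pose y' : induced (y |: S) := exist _ y yS'.
pose x' : induced S := exist _ x xS.
have sym : connect_sym (@adj (induced (y |: S))).
  by apply: sym_connect_sym; apply: adj_sym.
have toy (t : induced (y |: S)) : connect (@adj _) t y'.
  case/setU1P: (valP t) => [ty | tS].
    by rewrite (_ : t = y') ?connect0 //; apply: val_inj.
  have -> : t = f (exist _ (val t) tS) by apply: val_inj.
  apply: connect_trans (cf _ x') _; apply: connect1; exact: xy.
apply/forallP => a; apply/forallP => b.
by apply: connect_trans (toy a) _; rewrite sym.
Qed.

(* An edge leaving the pendant tree elsewhere than at [v] would end on [C] by
   maximality of the tree, and would close a second cycle. *)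
Lemma pendant_set_boundary x y : x \in pendant_set C v ->
  y \notin pendant_set C v -> adj x y -> x = v.
Proof.
move=> xP yP xy; have [/and3P[cP vP PC] Pmax] := pendant_setP.
apply/eqP/negPn/negP => xv.
have yC : y \in C.
  apply: contraNT yP => yC.
  suff /Pmax : pendant_cand C v (y |: pendant_set C v).
    by rewrite cardsU1; case: (y \in _) => //; rewrite add1n ltnn.
  apply/and3P; split; first exact: connected_setU1 xy.
    by rewrite in_setU1 vP orbT.
  apply/forall_inP => t /setU1P[-> | tP]; first by rewrite (negPf yC).
  exact: (forall_inP PC).
have yv : y != v by apply: contraNneq yP => ->.
have := forallP (forallP cP (pendant_root C v)) (exist _ x xP).
case/connectP => p0 pp0; case: (shortenP pp0) => p pp up _ {p0 pp0} xE.
pose q := map val p.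
have pq : path (@adj G) v q by rewrite -[v]/(val (pendant_root C v)) path_map.
have lq : last v q = x by rewrite -[v]/(val (pendant_root C v)) last_map -xE.
have uq : uniq (v :: q) by rewrite -(map_inj_uniq val_inj) in up.
(* The tree meets [C] only in [v], and the simple path does not return to [v]. *)
have qC t : t \in q -> t \notin C.
  move=> /mapP[s sp ->]; apply/negP => /(pendant_set_cycle (valP s)) sv.
  case/andP: up => /negP[]; suff <- : s = pendant_root C v by [].
  exact: val_inj.
have xq : x \in q.
  by move: (mem_last v q); rewrite lq in_cons (negPf xv).
have [i c iE] := rot_to hv.
have cC : [:: v & c] =i C by move=> t; rewrite -iE mem_rot.
have /andP[cc uc] : ucycleb (@adj G) (v :: c).
  by rewrite -iE /ucycleb rot_cycle rot_uniq; case/andP: hC.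
have yc : y \in c by move: yC; rewrite -cC in_cons (negPf yv).
case: (splitPr yc) cc uc cC => a b cc uc cC.
(* The second cycle follows [q] from [v] to [x], crosses to [y] and returns to [v] along [C]; it
   contains [x], which is off [C]. *)
have hc : is_cycle (v :: q ++ y :: b).
  apply/and3P; split.
  - by case: (q) xq => //= *; rewrite size_cat /= addnS.
  - rewrite /= rcons_cat cat_path pq lq /= xy /=.
    by move: cc; rewrite /= rcons_cat cat_path /= => /and3P[].
  - rewrite -cat_cons cat_uniq uq; move: uc; rewrite -cat_cons cat_uniq.
    case/and3P=> _ /hasPn vb ->; rewrite andbT; apply/hasPn => t tb.
    rewrite /= in_cons negb_or; apply/andP; split.
      by have := vb t tb; rewrite /= in_cons negb_or => /andP[].
    apply/negP => /qC; rewrite -cC in_cons mem_cat tb !orbT; exact: negP.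
have := qC x xq; rewrite -(unicyclic_mem_cycle hc) in_cons mem_cat xq !orbT.
by [].
Qed.

Lemma alpha_pendant (I : {set pendant_tree C v}) :
  independent I -> #|I| = alpha (pendant_tree C v) ->
  pendant_root C v \notin I ->
  alpha G = (alpha (pendant_tree C v) + alpha (pendant_compl C v))%N.
Proof.
move=> iI cI vI; set P := pendant_set C v; apply/eqP; rewrite eqn_leq.
rewrite /pendant_compl -alpha_inT; apply/andP; split.
  apply: alpha_in_leq => J iJ _; rewrite -(cardsID P J) setDE.
  by rewrite !alpha_induced leq_add // leq_alpha_in ?subsetIr // (independentS _ iJ) ?subsetIl.
have [J [iJ sJ cJ]] := alpha_in_max (~: P).
rewrite alpha_induced -cJ -cI -(card_imset _ val_inj).
set I' := val @: I.
have sI : I' \subset P by apply: imset_val_sub.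
have vI' : v \notin I'.
  apply: contraNN vI => /imsetP[t tI tv].
  by rewrite (_ : pendant_root C v = t) //; apply: val_inj.
have JP y : y \in J -> y \notin P by move=> /(subsetP sJ); rewrite inE.
have dIJ : [disjoint I' & J].
  by rewrite disjoint_subset; apply/subsetP => t /(subsetP sI) tP; rewrite !inE;
    apply/negP => /JP; rewrite tP.
have -> : (#|I'| + #|J| = #|I' :|: J|)%N.
  by apply/esym/eqP; rewrite (leq_card_setU I' J).
apply: leq_alpha_in (subsetT _).
have iI' : independent I' by rewrite independent_imset_val.
(* An edge between the two sets would leave the tree, hence start at [v], which [I'] avoids. *)
have cross x y : x \in I' -> y \in J -> ~~ adj x y.
  move=> xI yJ; apply: contraNN vI' => xy.
  by rewrite -(pendant_set_boundary (subsetP sI x xI) (JP y yJ) xy).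
move/independentP: iI' => iI'; move/independentP: iJ => iJ.
apply/independentP => x y /setUP[xI | xJ] /setUP[yI | yJ].
- exact: iI'.
- exact: cross.
- by rewrite adj_sym cross.
- exact: iJ.
Qed.

End Unicyclic.

Theorem theorem4p7 (R : realType) (G : sgraph) (C : seq G) (v : G)
    (hG : unicyclic G) (hC : is_cycle C) (hI : typeI C) (hv : v \in C)
    (hvS : pendant_root C v \notin Supp R (pendant_tree C v)) :
  (alpha G)%:R =
    #|Supp R (pendant_tree C v)|%:R + #|Supp R (pendant_compl C v)|%:R
    + (#|NForest R (pendant_tree C v)|%:R
       + #|NForest R (pendant_compl C v)|%:R) / 2 :> R.
Proof.
have ac1 := acyclic_pendant_tree hG hC (v := v).
have ac2 := acyclic_pendant_compl hG hC hv.
have [I [iI cI vI]] := acyclic_max_independent_avoid ac1 hvS.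
have two0 : 2 != 0 :> R by rewrite pnatr_eq0.
(* Doubling clears the fraction and leaves an identity between natural numbers. *)
apply: (mulIf two0); rewrite mulrDl divfK // -!natrD -!natrM -natrD; congr _%:R.
rewrite (alpha_pendant hG hC hv iI cI vI) !muln2 !doubleD.
by rewrite (acyclic_alpha R ac1) (acyclic_alpha R ac2) addnACA.
Qed.
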